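(* Let $W$ be a finite Weyl group and let $w\in W$. Then $\underline{H}_w^2=a\underline{H}_w$ for some $a\in\mathbb{A}=\mathbb{Z}[v,v^{-1}]$ if and only if $w$ is the longest element $w'_0$ of some parabolic subgroup $W'$ of $W$.
   Context: Let $W$ be a finite Weyl group with set $S$ of simple reflections and identity $e$. A parabolic subgroup of $W$ is a subgroup generated by a subset of $S$. Put $\mathbb{A}=\mathbb{Z}[v,v^{-1}]$. The Hecke algebra $\mathbf{H}$ of $W$ is the $\mathbb{A}$-algebra generated by $H_s$, $s\in S$, subject to the braid relations of $(W,S)$ and $H_s^2=H_e+(v^{-1}-v)H_s$; it has the standard $\mathbb{A}$-basis $\{H_w : w\in W\}$, where $H_w=H_{s_1}\cdots H_{s_k}$ for any reduced expression $w=s_1\cdots s_k$. The bar involution is the ring automorphism of $\mathbf{H}$ with $\overline{v}=v^{-1}$ and $\overline{H_s}=H_s^{-1}$. The Kazhdan-Lusztig (KL) basis $\{\underline{H}_w : w\in W\}$ is uniquely determined by $\overline{\underline{H}_w}=\underline{H}_w$ and $\underline{H}_w\in H_w+\sum_{x\in W}v\mathbb{Z}[v]H_x$. *)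

(* Defs.v *)
From HB Require Import structures.
From mathcomp Require Import all_boot all_order all_algebra all_fingroup.
From mathcomp Require Import boolp reals.

Set Implicit Arguments.
Unset Strict Implicit.
Unset Printing Implicit Defensive.

Import GRing.Theory.
Local Open Scope ring_scope.

(* Z[v, v^-1], as a subring of Q(v) = {fraction {poly int}}. *)
Definition is_laurent : {pred {fraction {poly int}}} :=
  [pred x | `[< exists (p : {poly int}) (n : nat),
                  x = tofrac p / tofrac 'X ^+ n >]].

Lemma is_laurent_subring : subring_closed is_laurent.
Proof.
have X0 n : tofrac 'X ^+ n != 0 :> {fraction {poly int}}.
  by rewrite expf_neq0// tofrac_eq0 polyX_eq0.
split.
- by apply/asboolP; exists 1, 0%N; rewrite expr0 divr1 tofrac1.
- move=> _ _ /asboolP[p [m ->]] /asboolP[q [n ->]]; apply/asboolP.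
  exists (p * 'X^n - q * 'X^m), (m + n)%N.
  rewrite tofracB !tofracM !tofracXn exprD mulrBl invfM; congr (_ - _).
    by rewrite [_^-1 * _]mulrC mulrA mulfK.
  by rewrite mulrA mulfK.
- move=> _ _ /asboolP[p [m ->]] /asboolP[q [n ->]]; apply/asboolP.
  by exists (p * q), (m + n)%N; rewrite tofracM exprD mulf_div.
Qed.

HB.instance Definition _ :=
  GRing.isSubringClosed.Build {fraction {poly int}} is_laurent
    is_laurent_subring.

Record laurent := Laurent {
  laurent_val : {fraction {poly int}};
  laurentP : laurent_val \in is_laurent
}.

HB.instance Definition _ := [isSub for laurent_val].
HB.instance Definition _ := [Choice of laurent by <:].
HB.instance Definition _ := [SubChoice_isSubComNzRing of laurent by <:].

Lemma v_laurent : tofrac 'X \in is_laurent.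
Proof. by apply/asboolP; exists 'X, 0%N; rewrite expr0 divr1. Qed.

Lemma vV_laurent : (tofrac 'X)^-1 \in is_laurent.
Proof. by apply/asboolP; exists 1, 1%N; rewrite tofrac1 div1r expr1. Qed.

Definition v : laurent := Laurent v_laurent.
Definition vV : laurent := Laurent vV_laurent.

Definition in_vZv (a : laurent) : Prop :=
  exists p : {poly int}, laurent_val a = tofrac ('X * p).

Section RootSystem.
Variables (R : realType) (n : nat).
Implicit Types (x y : 'rV[R]_n) (Phi Delta : seq 'rV[R]_n).

Definition dot x y : R := (x *m y^T) 0 0.

Definition cartan x y : R := 2 * dot x y / dot y y.

Definition reflection x y : 'rV[R]_n := y - cartan y x *: x.

Record root_system Phi : Prop := RootSystem {
  root_span : <<Phi>>%VS = fullv;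
  root_neq0 : forall a, a \in Phi -> a != 0;
  root_reduced : forall a (c : R), a \in Phi -> c *: a \in Phi ->
    c = 1 \/ c = -1;
  root_refl : forall a b, a \in Phi -> b \in Phi -> reflection a b \in Phi;
  root_int : forall a b, a \in Phi -> b \in Phi -> cartan b a \is a Num.int
}.

Record root_base Phi Delta : Prop := RootBase {
  base_sub : {subset Delta <= Phi};
  base_basis : basis_of fullv Delta;
  base_sign : forall b, b \in Phi -> exists c : nat -> nat,
    b = \sum_(i < size Delta) Delta`_i *+ c i \/
    b = - \sum_(i < size Delta) Delta`_i *+ c i
}.

(* Since Phi spans the space, its Weyl group acts faithfully on Phi, and is
   identified with the group of permutations of Phi that it induces. As g * h
   is h \o g for permutations, this is a right action, which does not affect
   the Coxeter group structure. *)
Definition induced_by Phi x (g : {perm seq_sub Phi}) : bool :=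
  [forall b : seq_sub Phi, val (g b) == reflection x (val b)].

Definition weyl_group Phi : {group {perm seq_sub Phi}} :=
  <<[set g | has (fun a => induced_by a g) Phi]>>%G.

Definition simple_reflections Phi Delta : {set {perm seq_sub Phi}} :=
  [set g | has (fun a => induced_by a g) Delta].

End RootSystem.

Section Hecke.
Variables (gT : finGroupType) (W S : {set gT}).

Definition expression (w : gT) (s : seq gT) : bool :=
  all (mem S) s && ((\prod_(x <- s) x)%g == w).

Definition has_expression_of_size (w : gT) (k : nat) : bool :=
  [exists s : k.-tuple gT, expression w s].

Lemma expression_exists (w : gT) :
  w \in <<S>>%g -> exists k, has_expression_of_size w k.
Proof.
case/gen_prodgP=> k [c Sc ->]; exists k; apply/existsP.
exists [tuple c i | i < k]; rewrite /expression big_tuple.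
apply/andP; split; first by apply/allP=> _ /mapP[i _ ->]; exact: Sc.
by apply/eqP; apply: eq_bigr => i _; rewrite tnth_mktuple.
Qed.

(* The value outside the subgroup generated by S is irrelevant. *)
Definition len (w : gT) : nat :=
  if @idP (w \in <<S>>%g) is ReflectT Sw then ex_minn (expression_exists Sw)
  else 0.

Definition reduced (w : gT) (s : seq gT) : bool :=
  expression w s && (size s == len w).

(* For W' = <<J>> with J \subset S, length with respect to J agrees with length
   with respect to S, and there is exactly one element of maximal length. *)
Definition longest_element (W' : {set gT}) (w : gT) : Prop :=
  w \in W' /\ forall x, x \in W' -> (len x <= len w)%N.

Definition parabolic (W' : {set gT}) : Prop :=
  exists2 J : {set gT}, J \subset S & W' = <<J>>%g.

Definition alternating (B : pzRingType) (a b : B) (m : nat) : B :=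
  \prod_(i < m) (if odd i then b else a).

Record hecke_relations (B : algType laurent) (h : gT -> B) : Prop :=
  HeckeRelations {
  hecke_braid : forall s t, s \in S -> t \in S ->
    alternating (h s) (h t) #[s * t]%g = alternating (h t) (h s) #[s * t]%g;
  hecke_quad : forall s, s \in S -> h s ^+ 2 = 1 + (vV - v) *: h s
}.

(* H is presented by the generators T s, s \in S, and the relations above. *)
Record hecke_algebra (H : algType laurent) (T : gT -> H) : Prop :=
  HeckeAlgebra {
  hecke_rel : hecke_relations T;
  hecke_univ : forall (B : algType laurent) (h : gT -> B),
    hecke_relations h ->
    exists f : {lrmorphism H -> B}, forall s, s \in S -> f (T s) = h s;
  hecke_uniq : forall (B : algType laurent) (f g : {lrmorphism H -> B}),
    (forall s, s \in S -> f (T s) = g (T s)) -> f =1 g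
}.

Section Bases.
Variables (H : algType laurent) (T Hw : gT -> H).

(* Only the formula defining H_w is recorded; that the H_w form a basis follows
   from the presentation of H. *)
Definition standard_basis : Prop :=
  forall w s, w \in W -> reduced w s -> Hw w = \prod_(x <- s) T x.

Record bar_involution (bar : {rmorphism H -> H}) : Prop := BarInvolution {
  bar_bij : bijective bar;
  bar_v : bar v%:A = vV%:A;
  bar_gen : forall s, s \in S -> bar (T s) * T s = 1 /\ T s * bar (T s) = 1
}.

Definition kl_basis (bar : {rmorphism H -> H}) (C : gT -> H) : Prop :=
  forall w, w \in W ->
    bar (C w) = C w /\
    exists2 p : gT -> laurent, forall x, x \in W -> in_vZv (p x) &
      C w = Hw w + \sum_(x in W) p x *: Hw x.

End Bases.
End Hecke.

(* Main.v *)
Require Import Defs.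
From HB Require Import structures.
From mathcomp Require Import all_boot all_order all_algebra all_fingroup.
From mathcomp Require Import cyclic ring boolp reals.

(* Write C_w = sum_x c_x H_x and let l be the length. If w is longest in the
   parabolic subgroup <J>, then every s in J is a descent of w, so that
   T_s C_w = v^-1 C_w; as C_w is supported on <J>, C_w^2 is a multiple of C_w.

   Conversely, let C_w^2 = a C_w. The character T_s |-> v^-1 does not kill C_w
   and takes it to a, hence v^l(w) a is 1 modulo vZ[v]. On the lattice spanned
   by the H_x over Z[v], the operator v T_s is, modulo v, the diagonal
   projection onto the H_x with sx < x; so v^l(w) C_w^2 is H_w modulo v if all
   letters of a reduced word of w are descents of w, and 0 otherwise. Hence they
   are all descents, i.e. w is longest in the subgroup they generate. *)

Set Implicit Arguments.
Unset Strict Implicit.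
Unset Printing Implicit Defensive.

Import Order.TTheory GRing.Theory Num.Theory.

(** * Length and the exchange condition *)

(** Of the root system only the exchange condition is passed on: the Hecke algebra part assumes an
    [exchange_system] and no geometry. Since H is given by generators and relations, the H_x are not
    known at the outset to be linearly independent, and without that no coefficient c_x makes sense.
    Coefficients therefore come from a concrete representation on functions on W; the difficulty
    there is the braid relation, and a commuting right action removes it. Length together with
    membership in <J> takes the place of the Bruhat order in the triangularity of bar. What makes
    bar-invariance effective is that a bar-invariant element of vZ[v] is 0: this gives both the
    support of C_w and its behaviour at descents. *)

Section Length.
Local Open Scope group_scope.
Variables (gT : finGroupType) (S : {set gT}).
Implicit Types (x y s t : gT) (r : seq gT) (J : {set gT}).

Lemma prod_mem_gen r : all (mem S) r -> \prod_(x <- r) x \in <<S>>.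
Proof.
elim: r => [|x r IHr] /=; first by rewrite big_nil group1.
by case/andP=> Sx /IHr Wr; rewrite big_cons groupM// mem_gen.
Qed.

Lemma expression_mem x r : expression S x r -> x \in <<S>>.
Proof. by case/andP=> /prod_mem_gen Sr /eqP<-. Qed.

Lemma len_le x r : expression S x r -> len S x <= size r.
Proof.
move=> xr; have Sx := expression_mem xr.
rewrite /len; case: {-}_ / idP => [Sx'|//].
case: ex_minnP => m _; apply; apply/existsP; exists (in_tuple r) => /=.
exact: xr.
Qed.

Lemma reduced_exists x : x \in <<S>> -> exists r, reduced S x r.
Proof.
move=> Sx; rewrite /reduced /len; case: {-}_ / idP => [Sx'|//].
case: ex_minnP => m /existsP[r xr] _; exists r.
by rewrite xr size_tuple /=.
Qed.

Lemma len1 : len S 1 = 0.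
Proof.
by apply/eqP; rewrite -leqn0 (@len_le 1 [::])// /expression big_nil eqxx.
Qed.

Lemma len_mul_le s x : s \in S -> x \in <<S>> -> len S (s * x) <= (len S x).+1.
Proof.
move=> Ss /reduced_exists[r /andP[/andP[Sr /eqP xr] /eqP<-]].
by apply: (@len_le _ (s :: r)); rewrite /expression /= Ss Sr big_cons xr /=.
Qed.

End Length.

(** All that the Hecke algebra part uses of the Weyl group. [exch_neq] stands in for the parity of
    the length, and [exch_del] is stated for arbitrary words, so that it applies to words not known
    to be reduced. *)
Record exchange_system (gT : finGroupType) (S : {set gT}) : Prop := {
  exch_invol : forall s, s \in S -> (s * s = 1)%g;
  exch_neq : forall s x, s \in S -> x \in <<S>>%g -> len S (s * x)%g != len S x;
  exch_del : forall s r, s \in S -> all (mem S) r ->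
    len S (s * \prod_(a <- r) a)%g < len S (\prod_(a <- r) a)%g ->
    exists r1 a r2, r = r1 ++ a :: r2 /\
      (\prod_(b <- r1 ++ r2) b = s * \prod_(a <- r) a)%g
}.

Section Exchange.
Local Open Scope group_scope.
Variables (gT : finGroupType) (S : {set gT}) (hS : exchange_system S).
Implicit Types (x y s t : gT) (r : seq gT) (J : {set gT}).

Local Notation l := (len S).

Lemma invS s : s \in S -> s^-1 = s.
Proof. by move=> Ss; apply/eqP; rewrite eq_invg_mul (exch_invol hS Ss). Qed.

Lemma mulSK s x : s \in S -> s * (s * x) = x.
Proof. by move=> Ss; rewrite mulgA (exch_invol hS Ss) mul1g. Qed.

Lemma memS s x : s \in S -> (s * x \in <<S>>) = (x \in <<S>>).
Proof. by move=> Ss; rewrite groupMl// mem_gen. Qed.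

Lemma memSr x t : t \in S -> (x * t \in <<S>>) = (x \in <<S>>).
Proof. by move=> St; rewrite groupMr// mem_gen. Qed.

Lemma prod_rev r : all (mem S) r -> \prod_(a <- rev r) a = (\prod_(a <- r) a)^-1.
Proof.
elim: r => [|a r IHr]; first by rewrite !big_nil invg1.
case/andP=> Sa Sr; rewrite rev_cons -cats1 big_cat big_seq1 big_cons invMg IHr//.
by rewrite (invS Sa).
Qed.

Lemma lenV x : x \in <<S>> -> l x^-1 = l x.
Proof.
have le y : y \in <<S>> -> l y^-1 <= l y.
  case/reduced_exists=> r /andP[/andP[Sr /eqP yr] /eqP<-].
  rewrite -size_rev; apply: len_le.
  by rewrite /expression all_rev Sr prod_rev// yr /=.
move=> Wx; apply/eqP; rewrite eqn_leq le//=.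
by rewrite -{1}[x]invgK le ?groupV.
Qed.

Lemma len_up s x : s \in S -> x \in <<S>> -> (l (s * x) < l x) = false ->
  l (s * x) = (l x).+1.
Proof.
move=> Ss Wx; have := exch_neq hS Ss Wx; have := len_mul_le Ss Wx.
by case: ltngtP => // h1 h2 _ _; apply/eqP; rewrite eqn_leq h1 h2.
Qed.

Lemma len_down s x : s \in S -> x \in <<S>> -> l (s * x) < l x ->
  l x = (l (s * x)).+1.
Proof.
move=> Ss Wx lt; have := @len_up s (s * x) Ss.
by rewrite memS// mulSK// => ->//; rewrite ltnNge ltnW.
Qed.

Lemma descentN s x : s \in S -> x \in <<S>> ->
  (l (s * (s * x)) < l (s * x)) = ~~ (l (s * x) < l x).
Proof.
move=> Ss Wx; rewrite mulSK//; have := exch_neq hS Ss Wx.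
by case: ltngtP.
Qed.

Lemma mulStK x t : t \in S -> x * t * t = x.
Proof. by move=> St; rewrite -mulgA (exch_invol hS St) mulg1. Qed.

(** Append t to a reduced word of x and delete a letter for s: unless the deleted letter is that t,
    the result is a word for [s * x] shorter than x, against the hypothesis. *)
Lemma exchange_commute s t x : s \in S -> t \in S -> x \in <<S>> ->
  (l (s * x) < l x) = false -> l (s * (x * t)) < l (x * t) -> s * x = x * t.
Proof.
move=> Ss St Wx up.
have [r /andP[/andP[Sr /eqP xr] /eqP rl]] := reduced_exists Wx.
have xtr : x * t = \prod_(a <- rcons r t) a.
  by rewrite -cats1 big_cat big_seq1 xr.
rewrite xtr => /(exch_del hS Ss)[]; first by rewrite all_rcons Sr /= St.
move=> r1 [a [r2 []]]; case: (lastP r2) => [|r2' b].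
  rewrite cats1 => /rcons_inj[<- _]; rewrite cats0 xr -xtr => {1}->.
  exact: mulSK.
rewrite -rcons_cons -!rcons_cat => -[/rcons_inj[er <-]].
rewrite -!cats1 !big_cat /= !big_seq1 mulgA -!(big_cat _ r1) => /mulIg sx.
move: up; rewrite -xr -sx => /negbT/negP[].
rewrite xr -rl er size_cat addnS ltnS -size_cat.
apply: len_le; rewrite /expression eqxx andbT; move: Sr; rewrite er !all_cat.
by case/andP=> -> /andP[].
Qed.

(** The word chosen for x is reduced with respect to J, while [l] is the length for S. Deletion
    keeps letters in J, so if the first letter shortened the rest, x would have a J-word shorter
    than a reduced one. *)
Lemma gen_ind J (P : gT -> Prop) : J \subset S -> P 1 ->
    (forall s x, s \in J -> x \in <<J>> -> l x < l (s * x) -> P x -> P (s * x)) ->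
  forall x, x \in <<J>> -> P x.
Proof.
move=> JS P1 PJ x; have [m] := ubnP (l x); elim: m x => // m IHm x ltm Jx.
have [r /andP[/andP[Jr /eqP xr] /eqP rl]] := reduced_exists Jx.
case: r => [|s r] in Jr xr rl; first by rewrite -xr big_nil.
have {Jr} /andP[Js Jr] : (s \in J) && all (mem J) r := Jr.
have Ss := subsetP JS _ Js.
have Sr : all (mem S) r by apply: sub_all Jr; apply/subsetP.
have JWs := genS JS.
have Wr := prod_mem_gen Sr; have JWr := prod_mem_gen Jr.
rewrite big_cons in xr.
have up : (l x < l (\prod_(a <- r) a)) = false.
  apply/negP; rewrite -xr => /(exch_del hS Ss)[]// r1 [a [r2 [er del]]].
  have: len J x <= size (r1 ++ r2).
    apply: len_le; rewrite /expression del xr eqxx andbT.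
    by move: Jr; rewrite er !all_cat /= => /and3P[-> _ ->].
  by rewrite -rl er /= !size_cat /= addnS ltnNge leqW.
have lt : l (\prod_(a <- r) a) < l x by rewrite -xr (len_up Ss Wr) ?xr.
rewrite -xr; apply: PJ => //; rewrite ?xr//.
by apply: IHm => //; apply: leq_trans lt _.
Qed.

(** * Alternating words in two simple reflections *)

Fixpoint alternate s t m : seq gT :=
  if m is m'.+1 then s :: alternate t s m' else [::].

Local Notation alt s t m := (\prod_(a <- alternate s t m) a).

Lemma size_alternate s t m : size (alternate s t m) = m.
Proof. by elim: m s t => //= m IHm s t; rewrite IHm. Qed.

Lemma all_alternate s t m : s \in S -> t \in S -> all (mem S) (alternate s t m).
Proof. by elim: m s t => //= m IHm s t Ss St; rewrite Ss IHm. Qed.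

Lemma alternate_period s t m r1 b a c r2 :
  alternate s t m = r1 ++ [:: b, a, c & r2] -> b = c.
Proof.
elim: r1 s t m => [|d r1 IHr] s t [|m]//=; last by case=> _ /IHr.
by case: m => [|[|m]]//= [-> _ ->].
Qed.

Lemma alternate_belast s t m r a :
  alternate s t m = rcons r a -> r = alternate s t m.-1.
Proof.
elim: r s t m => [|b r IHr] s t [|m]//=; first by case: m.
by move=> [-> ertm]; rewrite (IHr _ _ _ ertm); case: m ertm => //; case: r {IHr}.
Qed.

Lemma altS s t m : alt s t m.+1 = s * alt t s m.
Proof. by rewrite /= big_cons. Qed.

Lemma alt_div s t m : s \in S -> t \in S ->
  alt s t m * (alt t s m)^-1 = (s * t) ^+ m.
Proof.
elim: m s t => [|m IHm] s t Ss St; first by rewrite /= big_nil mulgV.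
rewrite !altS invMg (invS St) -mulgA [alt t s m * _]mulgA IHm// expgS.
rewrite -!mulgA; congr (s * _).
by elim: m {IHm} => [|m IHm]; rewrite ?mulg1 ?mul1g// !expgS -!mulgA IHm.
Qed.

(* If s is a descent of the alternating word y of length k, then exchange
   exhibits y as the alternating word starting with the other letter, whence
   (s * t) ^+ k = 1. *)
Lemma len_alternate s t m : s \in S -> t \in S -> m <= #[s * t] ->
  l (alt s t m) = m.
Proof.
elim: m s t => [|k IHk] s t Ss St; first by rewrite /= big_nil len1.
move=> le_km; have tsm : #[t * s] = #[s * t].
  have -> : t * s = (s * t) ^ s by rewrite conjgE -!mulgA mulKg.
  exact: orderJ.
set y := alt t s k.
have yk : l y = k by apply: IHk; rewrite ?tsm ?(ltnW le_km).
have Sw := all_alternate k St Ss.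
have Wy : y \in <<S>> by apply: prod_mem_gen.
rewrite altS -/y; case: (boolP (l (s * y) < l y)) => [dn|/negbTE up]; last first.
  by rewrite len_up// yk.
have [//|r1 [a [r2 [er del]]]] := exch_del hS Ss _ dn.
have szr : (size (r1 ++ r2)).+1 = k.
  by rewrite size_cat -addnS -(size_alternate t s k) er size_cat.
have no_short r : all (mem S) r -> (size r).+2 <= k ->
    \prod_(b <- r) b != s * y.
  move=> Sr short; apply: contraTneq short => rsy.
  rewrite -yk (len_down Ss Wy dn) ltnS -leqNgt -rsy.
  by apply: len_le; rewrite /expression Sr eqxx.
have Sw' : all (mem S) (r1 ++ r2).
  by move: Sw; rewrite er !all_cat /= => /and3P[-> _ ->].
(* The deleted letter is the first, the last or an inner one of y. Deleting the first would shorten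
   y by two letters or give s * t = 1; an inner one has equal neighbours, which cancel and leave a
   word too short for [s * y]. *)
case: (lastP r1) => [|r1' b] in er del szr Sw';
  last case: r2 => [|c r2] in er del szr Sw'.
- case ek: k er => [|[|j]] //= [_ er2].
    move: del; rewrite -er2 /y ek altS /= big_nil mulg1 => /esym st1.
    by move: le_km; rewrite ek st1 order1.
  have yE : y = alt t s j.
    by rewrite -[y](mulSK _ Ss) -del -er2 /= big_cons mulSK.
  have : l y <= j.
    rewrite yE -{2}(size_alternate t s j); apply: len_le.
    by rewrite /expression all_alternate ?eqxx.
  by rewrite yk ek ltnNge leqnSn.
- rewrite cats1 in er; rewrite cats0 (alternate_belast er) in del.
  have k_gt0 : 0 < k by rewrite -szr.
  have yE : y = alt s t k.
    by rewrite -[y](mulSK _ Ss) -del -{2}(prednK k_gt0) altS.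
  have /eqP : (s * t) ^+ k = 1 by rewrite -alt_div// -yE mulgV.
  by rewrite -order_dvdn => /(dvdn_leq k_gt0); rewrite leqNgt le_km.
- have bc : b = c.
    by apply: (@alternate_period t s k r1' b a c r2); rewrite er cat_rcons.
  rewrite !cat_rcons -{c}bc in er del szr Sw'.
  move: Sw' szr; rewrite all_cat size_cat /= => /and4P[Sr1 Sb _ Sr2] szr.
  have /negP[] : \prod_(b <- r1' ++ r2) b != s * y.
    by apply: no_short; rewrite ?all_cat ?Sr1// size_cat -szr !addnS.
  by rewrite -[s * y]del !big_cat !big_cons /= mulSK.
Qed.

Lemma alt_order s t : s \in S -> t \in S -> alt s t #[s * t] = alt t s #[s * t].
Proof. by move=> Ss St; apply/eqP; rewrite eq_mulgV1 alt_div// expg_order. Qed.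

End Exchange.

Local Open Scope ring_scope.

(** * Weyl groups of root systems *)

Section Euclidean.
Variables (R : realType) (n : nat).
Implicit Types (x y z : 'rV[R]_n).

Lemma dotE x y : dot x y = \sum_i x 0 i * y 0 i.
Proof. by rewrite /dot mxE; apply: eq_bigr => i _; rewrite mxE. Qed.

Lemma dotC x y : dot x y = dot y x.
Proof. by rewrite !dotE; apply: eq_bigr => i _; rewrite mulrC. Qed.

Lemma dotDl x y z : dot (x + y) z = dot x z + dot y z.
Proof. by rewrite /dot mulmxDl mxE. Qed.

Lemma dotZl a x z : dot (a *: x) z = a * dot x z.
Proof. by rewrite /dot -scalemxAl mxE. Qed.

Lemma dotNl x z : dot (- x) z = - dot x z.
Proof. by rewrite -scaleN1r dotZl mulN1r. Qed.

Lemma dotDr x y z : dot z (x + y) = dot z x + dot z y.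
Proof. by rewrite !(dotC z) dotDl. Qed.

Lemma dotZr a x z : dot z (a *: x) = a * dot z x.
Proof. by rewrite !(dotC z) dotZl. Qed.

Lemma dotNr x z : dot z (- x) = - dot z x.
Proof. by rewrite !(dotC z) dotNl. Qed.

Lemma dot_gt0 x : x != 0 -> 0 < dot x x.
Proof.
move=> x_neq0; rewrite dotE lt_neqAle sumr_ge0 => [|i _]; last first.
  by rewrite -expr2 sqr_ge0.
rewrite andbT eq_sym; apply: contra x_neq0.
rewrite psumr_eq0 => [|i _]; last by rewrite -expr2 sqr_ge0.
move=> /allP x0; apply/eqP/rowP=> i; rewrite !mxE.
by have := x0 i; rewrite mem_index_enum mulf_eq0 orbb => /(_ isT)/eqP.
Qed.

Lemma reflection_self x : x != 0 -> reflection x x = - x.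
Proof.
move/dot_gt0/lt0r_neq0 => xx; rewrite /reflection /cartan mulfK//.
by rewrite scaler_nat mulr2n opprD addNKr.
Qed.

Lemma reflectionN x y : reflection (- x) y = reflection x y.
Proof.
by rewrite /reflection /cartan dotNl !dotNr opprK mulrN mulNr scalerN scaleNr opprK.
Qed.

Lemma dot_reflection x y z : x != 0 ->
  dot (reflection x y) (reflection x z) = dot y z.
Proof.
move/dot_gt0/lt0r_neq0 => xx; rewrite /reflection /cartan.
rewrite !(dotDl, dotDr, dotNl, dotNr, dotZl, dotZr) (dotC x z).
by field.
Qed.

Lemma cartan_reflection x y z : x != 0 ->
  cartan (reflection x y) (reflection x z) = cartan y z.
Proof. by move=> x0; rewrite /cartan !dot_reflection. Qed.

Lemma reflectionB_scale x y z a :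
  reflection x (y - a *: z) = reflection x y - a *: reflection x z.
Proof.
rewrite /reflection /cartan dotDl dotNl dotZl.
by apply/rowP=> i; rewrite !mxE; ring.
Qed.

Lemma reflection_conj x y z : x != 0 ->
  reflection x (reflection y z) = reflection (reflection x y) (reflection x z).
Proof.
move=> x0; rewrite [reflection y z]/reflection reflectionB_scale.
by rewrite -(cartan_reflection z y x0).
Qed.

Lemma reflectionK x : x != 0 -> involutive (reflection x).
Proof.
move=> x0 y; rewrite [reflection x y]/reflection reflectionB_scale.
by rewrite reflection_self// scalerN opprK subrK.
Qed.

End Euclidean.

(** * Positive roots, simple reflections and the exchange condition *)

Section Roots.
Variables (R : realType) (n : nat) (Phi Delta : seq 'rV[R]_n).
Hypotheses (hPhi : root_system Phi) (hDelta : root_base Phi Delta).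
Implicit Types (a b : seq_sub Phi) (g : {perm seq_sub Phi}).

Lemma root_val_neq0 a : val a != 0.
Proof. exact: root_neq0 (valP a). Qed.

Definition refl_root a b : seq_sub Phi :=
  SeqSub (root_refl hPhi (valP a) (valP b)).

Lemma refl_root_inj a : injective (refl_root a).
Proof.
move=> b c /(congr1 val) /= /(can_inj (reflectionK (root_val_neq0 a))).
exact: val_inj.
Qed.

Definition rperm a : {perm seq_sub Phi} := perm (@refl_root_inj a).

Lemma rpermE a b : val (rperm a b) = reflection (val a) (val b).
Proof. by rewrite permE. Qed.

Lemma induced_by_rperm (x : 'rV[R]_n) g (Px : x \in Phi) :
  induced_by x g = (g == rperm (SeqSub Px)).
Proof.
apply/forallP/eqP => [gx|-> b]; last by rewrite rpermE.
by apply/permP=> b; apply: val_inj; rewrite (eqP (gx b)) rpermE.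
Qed.

Lemma has_induced_by (X : seq 'rV[R]_n) g : {subset X <= Phi} ->
  reflect (exists2 a, val a \in X & g = rperm a) (has (fun x => induced_by x g) X).
Proof.
move=> XPhi; apply: (iffP hasP) => [[x Xx gx]|[a Xa ->]].
  by exists (SeqSub (XPhi _ Xx)) => //; apply/eqP; rewrite -induced_by_rperm.
exists (val a) => //; rewrite (induced_by_rperm _ (valP a)).
by apply/eqP/permP => b; apply: val_inj; rewrite !rpermE.
Qed.

Lemma simple_reflectionsP g :
  reflect (exists2 a, val a \in Delta & g = rperm a)
    (g \in simple_reflections Phi Delta).
Proof. by rewrite inE; apply/has_induced_by/(base_sub hDelta). Qed.

Lemma rpermK a : (rperm a * rperm a = 1)%g.
Proof.
apply/permP=> b; rewrite permM perm1; apply: val_inj.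
by rewrite !rpermE reflectionK ?root_val_neq0.
Qed.

(** Generators act by isometries, so conjugation carries the reflection in a root to that in its
    image; as products compose from left to right, this reads g^-1 s_a g = s_{g a}. *)
Lemma weyl_conj g a : g \in weyl_group Phi ->
  (rperm a * g = g * rperm (g a))%g.
Proof.
move=> Wg; suff ga b c : g (rperm b c) = rperm (g b) (g c).
  by apply/permP=> b; rewrite !permM ga.
have /gen_prodgP[k [f Wf ->]] := Wg.
elim: k f Wf {Wg} b c => [|k IHk] f Wf b c; first by rewrite big_ord0 !perm1.
rewrite big_ord_recr /= !permM IHk//.
move: (Wf ord_max); rewrite inE => /has_induced_by[//|d _ ->].
by apply: val_inj; rewrite !rpermE reflection_conj ?root_val_neq0.
Qed.

Lemma rperm_weyl a : rperm a \in weyl_group Phi.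
Proof.
apply: mem_gen; rewrite inE; apply/has_induced_by => //.
by exists a => //; exact: valP.
Qed.

(** The root -a, obtained as the image of a under its own reflection, which lies in Phi by
    [root_refl]. *)
Definition opp_root a := rperm a a.

Lemma val_opp a : val (opp_root a) = - val a.
Proof. by rewrite rpermE reflection_self ?root_val_neq0. Qed.

Lemma rperm_opp a : rperm (opp_root a) = rperm a.
Proof.
apply/permP=> b; apply: val_inj.
by rewrite (rpermE (opp_root a)) (rpermE a) val_opp reflectionN.
Qed.

Lemma weyl_opp g a : g \in weyl_group Phi -> g (opp_root a) = opp_root (g a).
Proof. by move=> /(@weyl_conj _ a)/permP/(_ a); rewrite !permM. Qed.

Local Notation crd := (coord (in_tuple Delta)).

Definition pos a := [forall i, 0 <= crd i (val a)].

Lemma base_free : free (in_tuple Delta).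
Proof. by have /andP[] := base_basis hDelta. Qed.

Lemma base_coord x : x = \sum_i crd i x *: Delta`_i.
Proof.
exact: (@coord_basis _ _ _ _ (in_tuple Delta) _ (base_basis hDelta) (memvf x)).
Qed.

Lemma coord_simple (i j : 'I_(size Delta)) : crd i (Delta`_j) = (j == i)%:R :> R.
Proof. exact: coord_free base_free. Qed.

Lemma pos_opp a : pos (opp_root a) = ~~ pos a.
Proof.
have [c ac] := base_sign hDelta (valP a).
have cE i : crd i (\sum_(i < size Delta) Delta`_i *+ c i) = (c i)%:R :> R.
  under eq_bigr do rewrite -scaler_nat.
  exact: (@coord_sum_free _ _ _ (in_tuple Delta) (fun i => (c i)%:R) i base_free).
have nz : exists i, crd i (val a) != 0.
  apply/existsP; apply: contraT => /existsPn a0.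
  case/negP: (root_val_neq0 a); rewrite (base_coord (val a)) big1// => i _.
  by move: (a0 i); rewrite negbK => /eqP->; rewrite scale0r.
case: nz => i0 nz0; have [a_ge0|a_le0] :
    (forall i, 0 <= crd i (val a)) \/ (forall i, crd i (val a) <= 0).
  case: ac => ->; [left|right] => i; first by rewrite cE; exact: ler0n.
  by rewrite linearN /= cE oppr_le0; exact: ler0n.
- have -> : pos a by apply/forallP.
  apply/negbTE/forallPn; exists i0; rewrite val_opp linearN /=.
  by rewrite -ltNge oppr_lt0 lt_neqAle eq_sym nz0 a_ge0.
- have -> : pos (opp_root a).
    by apply/forallP=> i; rewrite val_opp linearN /= oppr_ge0.
  by apply/esym/forallPn; exists i0; rewrite -ltNge lt_neqAle nz0 a_le0.
Qed.

Lemma pos_simple a : val a \in Delta -> pos a.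
Proof.
move=> /(nthP 0)[j ltj aj]; apply/forallP => i; rewrite -aj.
by rewrite (coord_simple i (Ordinal ltj)) ler0n.
Qed.

(** The reflection in a changes only the coordinate of b along a. Were the image negative, all other
    coordinates of b would vanish, and b would be a multiple of a, hence a itself since Phi is
    reduced and b positive. *)
Lemma pos_rperm a b : val a \in Delta -> pos b -> b != a -> pos (rperm a b).
Proof.
move=> aD pb ba; apply: contraNT ba; rewrite -pos_opp => npb.
have [j ltj aj] := nthP 0 aD.
have crd0 i : i != Ordinal ltj -> crd i (val b) = 0.
  move=> ij; apply/eqP; rewrite eq_le (forallP pb) andbT.
  have := forallP npb i; rewrite val_opp rpermE linearN linearB linearZ /=.
  rewrite -aj (coord_simple i (Ordinal ltj)) eq_sym (negbTE ij) mulr0 subr0.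
  by rewrite oppr_ge0.
have bE : val b = crd (Ordinal ltj) (val b) *: val a.
  rewrite {1}(base_coord (val b)) (bigD1 (Ordinal ltj))//= aj big1 ?addr0//.
  by move=> i ij; rewrite crd0// scale0r.
have := root_reduced hPhi (valP a) (c := crd (Ordinal ltj) (val b)).
rewrite -bE => /(_ (valP b))[] c1; apply/eqP/val_inj; rewrite bE c1.
  by rewrite scale1r.
by have := forallP pb (Ordinal ltj); rewrite c1 oppr_ge0 ler10.
Qed.

Lemma exists_acute b : pos b ->
  exists2 a : seq_sub Phi, val a \in Delta & 0 < dot (val b) (val a).
Proof.
move=> pb; apply: contrapT => noa.
have := dot_gt0 (root_val_neq0 b); rewrite {2}(base_coord (val b)) ltNge.
case/negP; rewrite /dot linear_sum /= mulmx_sumr summxE sumr_le0// => i _.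
rewrite linearZ -scalemxAr mxE mulr_ge0_le0 ?(forallP pb)//.
have iD := mem_nth 0 (ltn_ord i).
rewrite leNgt; apply/negP=> lt; apply: noa.
by exists (SeqSub (base_sub hDelta iD)).
Qed.

Local Notation W := (<<simple_reflections Phi Delta>>)%g.

Lemma simple_rperm a : val a \in Delta -> rperm a \in simple_reflections Phi Delta.
Proof. by move=> aD; apply/simple_reflectionsP; exists a. Qed.

(* Induction on the height of a positive root b: reflecting b in a simple root
   at an acute angle lowers the height. *)
Lemma rperm_gen a : rperm a \in W.
Proof.
wlog pa : a / pos a.
  move=> IH; case: (boolP (pos a)) => [/IH//|].
  by rewrite -pos_opp -rperm_opp => /IH.
pose ht b := \sum_i crd i (val b).
(* Heights are real numbers here, so the induction runs on the number of positive roots of smaller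
   height. *)
pose below b := [set c | pos c & ht c < ht b].
have [m] := ubnP #|below a|; elim: m => // m IHm in a pa *; rewrite ltnS => le_m.
case: (boolP (val a \in Delta)) => [aD|aD]; first exact/mem_gen/simple_rperm.
have [c cD ac] := exists_acute pa.
have ac' : a != c by apply: contraNneq aD => ->.
have Wc : rperm c \in W by apply/mem_gen/simple_rperm.
have pca := pos_rperm cD pa ac'.
have -> : rperm a = (rperm c * rperm (rperm c a) * rperm c)%g.
  by rewrite -weyl_conj ?rperm_weyl// -mulgA rpermK mulg1.
rewrite !groupM// IHm// (leq_trans _ le_m)//.
have lt_ht : ht (rperm c a) < ht a.
  have [j ltj cj] := nthP 0 cD.
  rewrite -subr_gt0 /ht -sumrB (bigD1 (Ordinal ltj))//= rpermE -cj.
  rewrite big1 => [|i ij]; rewrite -linearB subKr linearZ /=.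
  - rewrite (coord_simple _ (Ordinal ltj)) eqxx mulr1 addr0 cj.
    by rewrite divr_gt0 ?mulr_gt0 ?dot_gt0 ?root_val_neq0.
  - by rewrite (coord_simple _ (Ordinal ltj)) eq_sym (negbTE ij) mulr0.
apply/proper_card/properP; split; last exists (rperm c a).
- by apply/subsetP=> b; rewrite !inE => /andP[-> /lt_trans]; apply.
- by rewrite inE pca.
- by rewrite inE ltxx andbF.
Qed.

Lemma weyl_group_gen : weyl_group Phi = W :> {set _}.
Proof.
apply/eqP; rewrite eqEsubset !gen_subG; apply/andP; split; apply/subsetP => g.
  by rewrite inE => /has_induced_by[//|a _ ->]; apply: rperm_gen.
by case/simple_reflectionsP=> a _ ->; apply: rperm_weyl.
Qed.

(** Follow b through the word. The letter at which it turns negative is, by [pos_rperm], the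
    reflection in the root that b has become; moved back to the front by [weyl_conj], it is
    [rperm b]. *)
Lemma del_root r b : all (mem (simple_reflections Phi Delta)) r ->
    pos b -> ~~ pos ((\prod_(x <- r) x)%g b) ->
  exists r1 c r2, r = r1 ++ c :: r2 /\
    (\prod_(x <- r1 ++ r2) x = rperm b * \prod_(x <- r) x)%g.
Proof.
elim: r b => [|c r IHr] b; first by rewrite big_nil perm1 => _ ->.
case/andP=> /simple_reflectionsP[d dD ->] Sr pb; rewrite big_cons permM.
have [->|bd] := eqVneq b d.
  by exists [::], (rperm d), r; rewrite mulgA rpermK mul1g.
move=> /(IHr _ Sr (pos_rperm dD pb bd))[r1 [c' [r2 [-> eqr]]]].
exists (rperm d :: r1), c', r2; split => //.
by rewrite /= !big_cons eqr !mulgA -(weyl_conj b (rperm_weyl d)).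
Qed.

(** A negative [x a] lets a letter be deleted from a reduced word. For the converse, apply this to
    [rperm a * x], which sends a to the opposite of [x a]. *)
Lemma descent_root a x : val a \in Delta -> x \in W ->
  (len (simple_reflections Phi Delta) (rperm a * x)
     < len (simple_reflections Phi Delta) x)%N = ~~ pos (x a).
Proof.
move=> aD.
have lt y : y \in W -> ~~ pos (y a) ->
    (len (simple_reflections Phi Delta) (rperm a * y)
       < len (simple_reflections Phi Delta) y)%N.
  move=> /reduced_exists[r /andP[/andP[Sr /eqP<-] /eqP<-]].
  move=> /(del_root Sr (pos_simple aD))[r1 [c [r2 [er del]]]].
  rewrite {2}er size_cat addnS ltnS -size_cat len_le// /expression del eqxx andbT.
  by move: Sr; rewrite er !all_cat /= => /and3P[-> _ ->].
move=> Wx; case: (boolP (pos (x a))) => [pxa|/(lt _ Wx)//].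
have Wax : (rperm a * x)%g \in W by rewrite groupM ?rperm_gen.
apply/negbTE; rewrite -leqNgt ltnW// -{1}[x]mul1g -(rpermK a) -mulgA lt//.
rewrite permM weyl_opp ?weyl_group_gen//.
by rewrite pos_opp negbK.
Qed.

Lemma weyl_exchange : exchange_system (simple_reflections Phi Delta).
Proof.
split => [s /simple_reflectionsP[a _ ->]|s x|s r].
- exact: rpermK.
- case/simple_reflectionsP=> a aD -> Wx; case: (boolP (pos (x a))) => pxa.
    have Wax : (rperm a * x)%g \in W by rewrite groupM ?rperm_gen.
    have := descent_root aD Wax; rewrite mulgA rpermK mul1g permM.
    rewrite weyl_opp ?weyl_group_gen// pos_opp pxa.
    by move=> lt; rewrite gtn_eqF.
  by rewrite ltn_eqF// descent_root.
- case/simple_reflectionsP=> a aD -> Sr.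
  by rewrite descent_root ?prod_mem_gen// => /(del_root Sr (pos_simple aD)).
Qed.

End Roots.

(** * Laurent polynomials *)

Section Laurent.
Implicit Types (a b : laurent) (p q : {poly int}).

Definition in_Zv a := exists p, laurent_val a = tofrac p.

Lemma val_laurentD a b : laurent_val (a + b) = laurent_val a + laurent_val b.
Proof. exact: (rmorphD (val : laurent -> {fraction {poly int}})). Qed.

Lemma val_laurentM a b : laurent_val (a * b) = laurent_val a * laurent_val b.
Proof. exact: (rmorphM (val : laurent -> {fraction {poly int}})). Qed.

Lemma val_laurentN a : laurent_val (- a) = - laurent_val a.
Proof. exact: (rmorphN (val : laurent -> {fraction {poly int}})). Qed.

Lemma val_laurent0 : laurent_val 0 = 0.
Proof. exact: (rmorph0 (val : laurent -> {fraction {poly int}})). Qed.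

Lemma val_laurent1 : laurent_val 1 = 1.
Proof. exact: (rmorph1 (val : laurent -> {fraction {poly int}})). Qed.

Lemma mul_vvV : v * vV = 1.
Proof.
apply: val_inj; rewrite rmorphM rmorph1 /= divff//.
by rewrite tofrac_eq0 polyX_eq0.
Qed.

Lemma in_ZvD a b : in_Zv a -> in_Zv b -> in_Zv (a + b).
Proof.
by case=> p ap [q bq]; exists (p + q); rewrite val_laurentD tofracD -ap -bq.
Qed.

Lemma in_ZvM a b : in_Zv a -> in_Zv b -> in_Zv (a * b).
Proof.
by case=> p ap [q bq]; exists (p * q); rewrite val_laurentM tofracM -ap -bq.
Qed.

Lemma in_ZvN a : in_Zv a -> in_Zv (- a).
Proof. by case=> p ap; exists (- p); rewrite val_laurentN tofracN -ap. Qed.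

Lemma in_Zv1 : in_Zv 1.
Proof. by exists 1; rewrite tofrac1 val_laurent1. Qed.

Lemma vZvP a : in_vZv a <-> exists2 b, in_Zv b & a = v * b.
Proof.
split=> [[p ap]|[b [p bp] ->]]; last first.
  by exists p; rewrite tofracM -bp val_laurentM.
exists (vV * a); last by rewrite mulrA mul_vvV mul1r.
exists p; rewrite val_laurentM ap tofracM mulKf//.
by rewrite tofrac_eq0 polyX_eq0.
Qed.

Lemma vZv_Zv a : in_vZv a -> in_Zv a.
Proof. by case=> p ap; exists ('X * p). Qed.

Lemma vZv0 : in_vZv 0.
Proof. by exists 0; rewrite mulr0 tofrac0 val_laurent0. Qed.

Lemma vZvD a b : in_vZv a -> in_vZv b -> in_vZv (a + b).
Proof.
by case=> p ap [q bq]; exists (p + q); rewrite val_laurentD mulrDr tofracD -ap -bq.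
Qed.

Lemma vZvN a : in_vZv a -> in_vZv (- a).
Proof. by case=> p ap; exists (- p); rewrite val_laurentN mulrN tofracN -ap. Qed.

Lemma vZvMl a b : in_Zv a -> in_vZv b -> in_vZv (a * b).
Proof.
case=> p ap [q bq]; exists (p * q).
by rewrite val_laurentM mulrCA tofracM -ap -bq.
Qed.

Lemma vZv_v : in_vZv v.
Proof. by exists 1; rewrite mulr1. Qed.

Lemma in_Zv_v n : in_Zv (v ^+ n).
Proof.
elim: n => [|n IHn]; first exact: in_Zv1.
by rewrite exprS; apply: in_ZvM IHn; apply/vZv_Zv/vZv_v.
Qed.

Lemma vZv_sum (I : Type) (r : seq I) (P : pred I) (F : I -> laurent) :
  (forall i, P i -> in_vZv (F i)) -> in_vZv (\sum_(i <- r | P i) F i).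
Proof. by move=> PF; elim/big_ind: _ => //; [exact: vZv0|exact: vZvD]. Qed.

Lemma vZv1N : ~ in_vZv 1.
Proof.
case=> p; rewrite val_laurent1 -tofrac1 => /eqP.
rewrite tofrac_eq => /eqP/(congr1 (coefp 0)) /=.
by rewrite coefXM coef1.
Qed.

Lemma laurent_mulIf a b c : a != 0 -> b * a = c * a -> b = c.
Proof.
move=> a0 /(congr1 laurent_val); rewrite !val_laurentM.
move=> /mulIf eqbc; apply: val_inj; apply: eqbc.
apply: contra a0 => /eqP a0; apply/eqP/val_inj; rewrite /= a0.
exact/esym/val_laurent0.
Qed.

(** Every Laurent polynomial is such a value at v times a power of [vV], and bar turns values at v
    into values at [vV]; this makes bar on scalars computable. *)
Definition eval_int a p : laurent := (map_poly intr p).[a].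

Lemma val_eval_v p : laurent_val (eval_int v p) = tofrac p.
Proof.
elim/poly_ind: p => [|p c IHp].
  by rewrite /eval_int map_poly0 horner0 tofrac0 val_laurent0.
rewrite /eval_int rmorphD rmorphM /= map_polyX map_polyC hornerMXaddC.
rewrite val_laurentD val_laurentM -/(eval_int v p) IHp.
rewrite tofracD tofracM; congr (_ + _).
have -> : c%:P = c%:~R by rewrite -[in LHS](intz c) rmorph_int.
by rewrite rmorph_int; exact: (rmorph_int (val : laurent -> {fraction {poly int}})).
Qed.

Lemma laurentE a : exists p n, a = eval_int v p * vV ^+ n.
Proof.
have /asboolP[p [n ap]] := laurentP a; exists p, n; apply: val_inj.
by rewrite rmorphM rmorphXn /= val_eval_v ap -exprVn.
Qed.

Lemma eval_intM a p q : eval_int a (p * q) = eval_int a p * eval_int a q.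
Proof. by rewrite /eval_int rmorphM hornerM. Qed.

Lemma eval_intXn a k : eval_int a 'X^k = a ^+ k.
Proof. by rewrite /eval_int map_polyXn hornerXn. Qed.

Lemma eval_int_sum a k p : (size p <= k)%N ->
  eval_int a p = \sum_(i < k) (p`_i)%:~R * a ^+ i.
Proof.
move=> szp; rewrite /eval_int (@horner_coef_wide _ k).
  by apply: eq_bigr => i _; rewrite coef_map.
exact: leq_trans (size_poly _ _) szp.
Qed.

(* After multiplication by v^(size p), both sides are values at v of integer
   polynomials, and the right one has degree less than size p. *)
Lemma eval_inv_eq0 p : eval_int v ('X * p) = eval_int vV ('X * p) -> p = 0.
Proof.
set k := size p; pose q := \poly_(i < k) p`_(k.-1 - i) => eqp.
suff eqX : 'X^(k.+1) * p = q.
  apply/eqP; apply: contraT => p0.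
  have := size_poly k (fun i => p`_(k.-1 - i)); rewrite -/q -eqX mulrC.
  by rewrite size_mulXn// -/k addSn ltnNge leq_addl.
apply/eqP; rewrite -tofrac_eq -!val_eval_v; apply/eqP; congr laurent_val.
rewrite exprSr -mulrA eval_intM eqp -['X in LHS]expr1 !eval_intM !eval_intXn.
rewrite (@eval_int_sum vV k)// (@eval_int_sum v k) ?size_poly//.
rewrite mulrA mulr_sumr (reindex_inj rev_ord_inj) /=; apply: eq_bigr => i _.
rewrite coef_poly ltn_ord mulrCA; congr (_ * _); first by rewrite subnS predn_sub.
rewrite -mulrA -exprS -subSn// subSS.
rewrite -{1}(subnKC (ltnW (ltn_ord i))) exprD -mulrA -exprMn mul_vvV.
by rewrite expr1n mulr1.
Qed.

(** * The bar involution on scalars *)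

Variables (H : algType laurent) (bar : {rmorphism H -> H}).
Hypothesis bar_v : bar v%:A = vV%:A.
Hypothesis alg_inj : injective (fun a : laurent => a%:A : H).

Lemma bar_vV : bar vV%:A = v%:A.
Proof.
have /(congr1 bar) := congr1 (in_alg H) mul_vvV.
rewrite !rmorphM !rmorph1 /= bar_v => /(congr1 ( *%R v%:A)).
by rewrite mulrA -[v%:A * vV%:A](rmorphM (in_alg H)) /= mul_vvV scale1r mul1r mulr1.
Qed.

Lemma bar_eval_v p : bar (eval_int v p)%:A = (eval_int vV p)%:A.
Proof.
elim/poly_ind: p => [|p c IHp].
  by rewrite /eval_int map_poly0 !horner0 scale0r rmorph0.
rewrite /eval_int rmorphD rmorphM /= map_polyX map_polyC !hornerMXaddC.
rewrite !scalerDl rmorphD /= -!/(eval_int _ p); congr (_ + _).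
  rewrite -[_%:A]/(in_alg H _) rmorphM rmorphM /= IHp bar_v.
  by rewrite -[RHS]/(in_alg H _) rmorphM.
by rewrite -!/(in_alg H _) !rmorph_int.
Qed.

Lemma bar_scalar :
  exists barK : laurent -> laurent, forall a, bar a%:A = (barK a)%:A.
Proof.
suff /boolp.choice[f fE] : forall a, exists b, bar a%:A = b%:A by exists f.
move=> a.
have [p [n ->]] := laurentE a; exists (eval_int vV p * v ^+ n).
rewrite -[_%:A]/(in_alg H _) -[RHS]/(in_alg H _) !rmorphM !rmorphXn /=.
by rewrite bar_eval_v bar_vV.
Qed.

(** Bar exchanges v and v^-1, so a fixed element of vZ[v] is a combination of positive powers of v
    and also one of negative powers. *)
Lemma bar_fixed_vZv a : in_vZv a -> bar a%:A = a%:A -> a = 0.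
Proof.
case=> p ap; have -> : a = eval_int v ('X * p).
  by apply: val_inj; rewrite /= val_eval_v.
rewrite bar_eval_v => /alg_inj/esym/eval_inv_eq0 ->.
by apply: val_inj; rewrite /= val_eval_v mulr0 tofrac0; apply/esym/val_laurent0.
Qed.

End Laurent.

(** * The regular representation of the Hecke algebra *)

Section RegularRepresentation.
Variables (gT : finGroupType) (S : {set gT}) (hS : exchange_system S).
Implicit Types (x y s t : gT) (r : seq gT) (F G : gT -> laurent).

Local Notation l := (len S).
Local Notation W := <<S>>%g.
Local Notation d := (vV - v).

(* The effect on coordinates in the basis (H_x) of left multiplication by T_s
   and of right multiplication by T_t. *)
Definition Lop s F x := F (s * x)%g + if (l (s * x)%g < l x)%N then d * F x else 0.
Definition Rop t F x := F (x * t)%g + if (l (x * t)%g < l x)%N then d * F x else 0.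
Definition delta x y : laurent := (x == y)%:R.
(** Equality on W only: outside W [len] is 0, so no descents occur there and the quadratic relation
    of [Lop_quad] fails. *)
Definition eqW F G := forall x, x \in W -> F x = G x.
Definition Lword r F := foldr Lop F r.

Lemma eqW_Lop s F G : s \in S -> eqW F G -> eqW (Lop s F) (Lop s G).
Proof. by move=> Ss FG x Wx; rewrite /Lop !FG// memS. Qed.

Lemma eqW_Lword r F G : all (mem S) r -> eqW F G -> eqW (Lword r F) (Lword r G).
Proof. by elim: r => //= s r IHr /andP[Ss Sr] FG; apply/eqW_Lop/IHr. Qed.

Lemma eqW_Rop t F G : t \in S -> eqW F G -> eqW (Rop t F) (Rop t G).
Proof. by move=> St FG x Wx; rewrite /Rop !FG// memSr. Qed.

(** Apply [exchange_commute] to x or to [s * x]: if right multiplication by t changes whether s is a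
    left descent, then [s * x = x * t]. *)
Lemma descent_stable s t x : s \in S -> t \in S -> x \in W ->
  (s * x)%g != (x * t)%g ->
  (l (s * (x * t))%g < l (x * t)%g)%N = (l (s * x)%g < l x)%N.
Proof.
move=> Ss St Wx sxt; case: (boolP (l (s * x)%g < l x)%N) => [dn|/negbTE up].
  apply: contraNT sxt.
  rewrite -(descentN hS) ?memSr// [(s * (x * t))%g]mulgA => dn'.
  have := exchange_commute hS Ss St (x := (s * x)%g).
  rewrite memS// (descentN hS)// dn => /(_ Wx erefl dn').
  by rewrite -mulgA => /mulgI->.
by apply: contraNF sxt => dn; apply/eqP; apply: (exchange_commute hS).
Qed.

Lemma descent_stabler s t x : s \in S -> t \in S -> x \in W ->
  (s * x)%g != (x * t)%g ->
  (l (s * x * t)%g < l (s * x)%g)%N = (l (x * t)%g < l x)%N.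
Proof.
move=> Ss St Wx sxt.
have Wsx : (s * x)%g \in W by rewrite memS.
have Wxt : (x * t)%g \in W by rewrite memSr.
have Wsxt : (s * x * t)%g \in W by rewrite memSr.
rewrite -[l (s * x * t)%g](lenV hS)// -[l (s * x)%g](lenV hS)//.
rewrite -[l (x * t)%g](lenV hS)//.
rewrite -[l x](lenV hS)// !invMg (invS hS Ss) (invS hS St).
apply: descent_stable; rewrite ?groupV//.
by rewrite -(inj_eq invg_inj) !invMg invgK (invS hS Ss) (invS hS St) eq_sym.
Qed.

(** If sx and xt differ, left and right descents do not influence each other; if they agree, both
    sides coincide term by term. *)
Lemma Lop_Rop s t F : s \in S -> t \in S ->
  eqW (Lop s (Rop t F)) (Rop t (Lop s F)).
Proof.
move=> Ss St x Wx; rewrite /Lop /Rop -!mulgA.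
case: (eqVneq (s * x)%g (x * t)%g) => [sxt|sxt]; last first.
  rewrite descent_stable// [(s * (x * t))%g]mulgA descent_stabler//.
  by case: ifP => _; case: ifP => _; ring.
by rewrite -sxt (mulSK hS).
Qed.

Lemma Lop_delta s x : s \in S -> x \in W -> (l (s * x)%g < l x)%N = false ->
  Lop s (delta x) =1 delta (s * x)%g.
Proof.
move=> Ss Wx up y; rewrite /Lop /delta.
have -> : (x == s * y)%g = (s * x == y)%g.
  by rewrite -(inj_eq (mulgI s)) (mulSK hS).
case: ifP => [dn|_]; last by rewrite addr0.
suff /negbTE-> : x != y by rewrite mulr0 addr0.
by apply: contraFneq up => ->.
Qed.

Lemma Rop_delta t x : t \in S -> x \in W -> (l (x * t)%g < l x)%N = false ->
  Rop t (delta x) =1 delta (x * t)%g.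
Proof.
move=> St Wx up y; rewrite /Rop /delta.
have -> : (x == y * t)%g = (x * t == y)%g.
  by rewrite -(inj_eq (mulIg t)) (mulStK hS).
case: ifP => [dn|_]; last by rewrite addr0.
suff /negbTE-> : x != y by rewrite mulr0 addr0.
by apply: contraFneq up => ->.
Qed.

Lemma Lop_quad s F : s \in S ->
  eqW (Lop s (Lop s F)) (fun x => F x + d * Lop s F x).
Proof.
move=> Ss x Wx; have := descentN hS Ss Wx; rewrite /Lop (mulSK hS)// => ->.
by case: (l _ < l x)%N => /=; ring.
Qed.

Lemma Lword_Rop r t F : all (mem S) r -> t \in S ->
  eqW (Lword r (Rop t F)) (Rop t (Lword r F)).
Proof.
move=> + St; elim: r => //= s r IHr /andP[Ss Sr] x Wx.
by rewrite (eqW_Lop Ss (IHr Sr))// Lop_Rop.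
Qed.

Lemma Lword_delta r : all (mem S) r -> l (\prod_(a <- r) a)%g = size r ->
  eqW (Lword r (delta 1)) (delta (\prod_(a <- r) a)%g).
Proof.
elim: r => [|s r IHr]; first by move=> _ _ x _; rewrite big_nil.
rewrite /= big_cons => /andP[Ss Sr] sz x Wx.
have Wr := prod_mem_gen Sr.
have le_r : (l (\prod_(a <- r) a)%g <= size r)%N.
  by apply: len_le; rewrite /expression Sr eqxx.
have lr : l (\prod_(a <- r) a)%g = size r.
  apply/eqP; rewrite eqn_leq le_r -ltnS -[(size r).+1]sz.
  exact: len_mul_le.
rewrite /= (eqW_Lop Ss (IHr Sr lr))// Lop_delta// sz lr /=.
by rewrite ltnNge leqnSn.
Qed.

(* By commutation with the operators Rop, which generate every delta x from
   delta 1, the braid relation need only be checked on delta 1. *)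
Lemma Lword_braid s t : s \in S -> t \in S -> forall x, x \in W ->
  eqW (Lword (alternate s t #[s * t]%g) (delta x))
      (Lword (alternate t s #[s * t]%g) (delta x)).
Proof.
move=> Ss St x; rewrite -[x]invgK groupV; move: x^-1%g => {x}.
have Sr := all_alternate #[s * t]%g Ss St.
have Sr' := all_alternate #[s * t]%g St Ss.
have ots : #[t * s]%g = #[s * t]%g.
  have -> : (t * s = (s * t) ^ s)%g by rewrite conjgE -!mulgA mulKg.
  exact: orderJ.
apply: (gen_ind hS (subxx S)) => [|a x Sa Wx up IHx] y Wy.
  rewrite invg1 Lword_delta ?(size_alternate) ?(len_alternate hS)//.
  rewrite Lword_delta ?(size_alternate) ?(len_alternate hS) ?ots//.
  by rewrite (alt_order hS).
have xa : eqW (delta (a * x)^-1%g) (Rop a (delta x^-1%g)).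
  move=> z Wz; rewrite invMg (invS hS Sa) Rop_delta ?groupV//.
  rewrite -{1}(invS hS Sa) -invMg !(lenV hS) ?memS//.
  by rewrite ltnNge ltnW.
rewrite (eqW_Lword Sr xa)// (eqW_Lword Sr' xa)// !Lword_Rop//.
exact: (eqW_Rop Sa IHx).
Qed.

Lemma alternating_word (B : pzRingType) (h : gT -> B) s t m :
  alternating (h s) (h t) m = \prod_(a <- alternate s t m) h a.
Proof.
elim: m s t => [|m IHm] s t; first by rewrite /alternating big_ord0 big_nil.
rewrite /alternating big_ord_recl /= big_cons -IHm; congr (_ * _).
by apply: eq_bigr => i _; rewrite /= /bump /=; case: odd.
Qed.

(* The size #|W| is written as a successor: only matrix rings of this form are
   known to be nontrivial. *)
Let ev (i : 'I_#|W|.-1.+1) : gT := nth 1%g (enum W) i.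
Let rk x : 'I_#|W|.-1.+1 := inord (index x (enum W)).

Lemma card_W_gt0 : (0 < #|W|)%N. Proof. exact: cardG_gt0. Qed.

Lemma ev_mem i : ev i \in W.
Proof.
by rewrite -mem_enum mem_nth// -cardE -[X in (_ < X)%N](prednK card_W_gt0).
Qed.

Lemma evK i : rk (ev i) = i.
Proof.
apply: val_inj; rewrite /rk /ev index_uniq ?enum_uniq ?inord_val//.
by rewrite -cardE -[X in (_ < X)%N](prednK card_W_gt0).
Qed.

Lemma rkK x : x \in W -> ev (rk x) = x.
Proof.
move=> Wx; rewrite /rk /ev inordK ?nth_index ?mem_enum//.
by rewrite (prednK card_W_gt0) cardE index_mem mem_enum.
Qed.

Lemma one_mxE i j : (1 : 'M[laurent]_(#|W|.-1.+1)) i j = delta (ev j) (ev i).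
Proof. by rewrite mxE /delta (inj_eq (can_inj evK)) eq_sym. Qed.

(** The universal property of H has algebras as targets, so the operators [Lop s] are turned into
    matrices. *)
Definition regular_mx s : 'M[laurent]_(#|W|.-1.+1) :=
  \matrix_(i, j) Lop s (delta (ev j)) (ev i).

Lemma sum_delta (i : 'I_#|W|.-1.+1) x (E : 'I_#|W|.-1.+1 -> laurent) : x \in W ->
  \sum_k delta (ev k) x * E k = E (rk x).
Proof.
move=> Wx; rewrite (bigD1 (rk x))//= /delta rkK// eqxx mul1r big1 ?addr0// => k kx.
suff /negbTE-> : ev k != x by rewrite mul0r.
by apply: contraNneq kx => <-; rewrite evK.
Qed.

Lemma regular_mxM s (M : 'M[laurent]_(#|W|.-1.+1)) i j : s \in S ->
  (regular_mx s *m M) i j = Lop s (fun x => M (rk x) j) (ev i).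
Proof.
move=> Ss; rewrite mxE; under eq_bigr do rewrite mxE /Lop mulrDl.
rewrite big_split /= sum_delta ?memS ?ev_mem//; congr (_ + _).
case: ifP => _; last by rewrite big1// => k _; rewrite mul0r.
by under eq_bigr do rewrite -mulrA; rewrite -mulr_sumr sum_delta// ev_mem.
Qed.

Lemma regular_mx_prod r i j : all (mem S) r ->
  (\prod_(a <- r) regular_mx a) i j = Lword r (delta (ev j)) (ev i).
Proof.
elim: r i => [|s r IHr] i /=.
  by rewrite big_nil one_mxE.
case/andP=> Ss Sr; rewrite big_cons regular_mxM//.
by apply: (eqW_Lop Ss); rewrite ?ev_mem// => x Wx; rewrite IHr// rkK.
Qed.

Lemma regular_mx_relations : hecke_relations S regular_mx.
Proof.
split=> [s t Ss St|s Ss].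
  rewrite !alternating_word; apply/matrixP=> i j.
  by rewrite !regular_mx_prod ?all_alternate// Lword_braid ?ev_mem.
apply/matrixP=> i j; rewrite expr2 regular_mxM//.
rewrite (eqW_Lop Ss (G := Lop s (delta (ev j)))) ?ev_mem//; last first.
  by move=> x Wx; rewrite mxE rkK.
by rewrite Lop_quad ?ev_mem// mxE one_mxE 2!mxE.
Qed.

(** The coefficients of h are read off from its action on the basis function at the identity, that
    is, from one column of its matrix. They later separate the H_x. *)
Lemma regular_coef (H : algType laurent) (T : gT -> H) : hecke_algebra S T ->
  exists cf : H -> gT -> laurent,
    [/\ forall a h h' x, cf (a *: h + h') x = a * cf h x + cf h' x,
        forall s h, s \in S -> eqW (cf (T s * h)) (Lop s (cf h)) &
        eqW (cf 1) (delta 1)].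
Proof.
move=> hH; have [f fT] := hecke_univ hH regular_mx_relations.
exists (fun h x => f h (rk x) (rk 1%g)); split.
- by move=> a h h' x; rewrite linearP !mxE.
- move=> s h Ss x Wx.
  by rewrite rmorphM /= fT// -[_ * _]/(_ *m _) regular_mxM// rkK.
by move=> x Wx; rewrite rmorph1 one_mxE !rkK.
Qed.

End RegularRepresentation.

(** * The Kazhdan-Lusztig basis *)

Section KazhdanLusztig.
Variables (gT : finGroupType) (S : {set gT}) (hS : exchange_system S).
Local Notation l := (len S).
Local Notation W := <<S>>%g.
Local Notation d := (vV - v).

Variables (H : algType laurent) (T Hw C : gT -> H) (bar : {rmorphism H -> H}).
Hypotheses (hH : hecke_algebra S T) (hHw : standard_basis W S T Hw).
Hypotheses (hbar : bar_involution S T bar) (hC : kl_basis W Hw bar C).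

(* cf h x is the coefficient of h on H_x. *)
Variable cf : H -> gT -> laurent.
Hypotheses (cfP : forall a h h' x, cf (a *: h + h') x = a * cf h x + cf h' x)
  (cfT : forall s h, s \in S -> eqW S (cf (T s * h)) (Lop S s (cf h)))
  (cf1 : eqW S (cf 1) (delta 1)).

Implicit Types (x y s t w : gT) (r : seq gT) (F G : gT -> laurent) (J : {set gT}).

Definition expand F := \sum_(x in W) F x *: Hw x.

Lemma Hw_1 : Hw 1%g = 1.
Proof.
rewrite (hHw (s := [::])) ?big_nil// ?group1//.
by rewrite /reduced /expression /= big_nil len1 !eqxx.
Qed.

Lemma T_Hw_up s x : s \in S -> x \in W -> (l (s * x)%g < l x)%N = false ->
  T s * Hw x = Hw (s * x)%g.
Proof.
move=> Ss Wx up; have [r rx] := reduced_exists Wx.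
rewrite (hHw Wx rx); have /andP[/andP[Sr /eqP xr] /eqP szr] := rx.
rewrite (hHw (w := (s * x)%g) (s := s :: r)) ?big_cons ?memS//.
by rewrite /reduced /expression /= big_cons xr Sr Ss szr (len_up hS) ?eqxx.
Qed.

Lemma quadT s : s \in S -> T s * T s = 1 + d *: T s.
Proof. by move=> Ss; rewrite -expr2 (hecke_quad (hecke_rel hH)). Qed.

Lemma T_Hw s x : s \in S -> x \in W ->
  T s * Hw x = Hw (s * x)%g + (if (l (s * x)%g < l x)%N then d else 0) *: Hw x.
Proof.
move=> Ss Wx; case: (boolP (l (s * x)%g < l x)%N) => [dn|/negbTE up]; last first.
  by rewrite T_Hw_up// scale0r addr0.
have <- : T s * Hw (s * x)%g = Hw x.
  rewrite T_Hw_up ?memS// ?(mulSK hS)//.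
  by have := descentN hS Ss Wx; rewrite dn (mulSK hS).
by rewrite mulrA quadT// mulrDl mul1r scalerAl.
Qed.

Lemma cf_Hw x : x \in W -> eqW S (cf (Hw x)) (delta x).
Proof.
move: x; apply: (gen_ind hS (subxx S)) => [|s x Ss Wx up IHx] y Wy.
  by rewrite Hw_1 cf1.
have up' : (l (s * x)%g < l x)%N = false by rewrite ltnNge ltnW.
rewrite -T_Hw_up// cfT// (eqW_Lop Ss IHx)//.
by rewrite (Lop_delta hS).
Qed.

Lemma cf0 x : cf 0 x = 0.
Proof.
have := cfP 1 0 0 x; rewrite scale1r mul1r addr0.
by move=> /(canLR (addrK _)); rewrite subrr.
Qed.

Lemma cf_sum (P : pred gT) F (h : gT -> H) x :
  cf (\sum_(y | P y) F y *: h y) x = \sum_(y | P y) F y * cf (h y) x.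
Proof.
elim/big_rec2: _ => [|y a b _ <-]; first exact: cf0.
by rewrite cfP.
Qed.

Lemma cf_expand F : eqW S (cf (expand F)) F.
Proof.
move=> x Wx; rewrite cf_sum (bigD1 x)//= cf_Hw// /delta eqxx mulr1 big1 ?addr0//.
by move=> y /andP[Wy /negbTE yx]; rewrite cf_Hw// /delta yx mulr0.
Qed.

Lemma T_expand s F : s \in S -> T s * expand F = expand (Lop S s F).
Proof.
move=> Ss; rewrite /expand mulr_sumr.
under eq_bigr => x Wx do rewrite -scalerAr T_Hw// scalerDr.
under [RHS]eq_bigr do rewrite scalerDl.
rewrite !big_split /=; congr (_ + _).
  rewrite (reindex_inj (mulgI s)) /=; apply: eq_big => [x|x _].
    by rewrite memS.
  by rewrite (mulSK hS).
by apply: eq_bigr => x _; rewrite scalerA; case: ifP; rewrite ?mulr0// mulrC.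
Qed.

Lemma prodT_expand r F : all (mem S) r ->
  (\prod_(a <- r) T a) * expand F = expand (Lword S r F).
Proof.
elim: r => [|s r IHr] /=; first by rewrite big_nil mul1r.
by case/andP=> Ss Sr; rewrite big_cons -mulrA IHr// T_expand.
Qed.

Lemma alg_inj : injective (fun a : laurent => a%:A : H).
Proof.
have cfA (a : laurent) : cf a%:A 1%g = a.
  by rewrite -[a%:A]addr0 cfP cf0 addr0 cf1 ?group1// /delta eqxx mulr1.
by move=> a b /= ab; rewrite -(cfA a) ab cfA.
Qed.

(** * Triangularity of the bar involution *)

Lemma barT s : s \in S -> bar (T s) = T s - d%:A.
Proof.
move=> Ss; have [barTs _] := bar_gen hbar Ss.
have TTd : T s * (T s - d%:A) = 1.
  by rewrite mulrBr quadT// -scalerAr mulr1 addrK.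
by rewrite -[LHS]mulr1 -[X in _ * X = _]TTd mulrA barTs mul1r.
Qed.

Lemma barT_expand s F : s \in S ->
  bar (T s) * expand F = expand (fun x => Lop S s F x - d * F x).
Proof.
move=> Ss; rewrite barT// mulrBl T_expand// -scalerAl mul1r.
rewrite /expand scaler_sumr -sumrB; apply: eq_bigr => x _.
by rewrite [RHS]scalerBl scalerA.
Qed.

(** The inverse of T_s is a combination of T_s and 1, so multiplying by it raises lengths by at most
    one and, for s in J, preserves the span of <J>. Carrying J along gives triangularity and support
    at once. *)
Lemma bar_Hw J x : J \subset S -> x \in <<J>>%g ->
  exists F, [/\ bar (Hw x) = expand F, F x = 1 &
    forall y, y \in W -> F y != 0 -> y != x -> (y \in <<J>>%g) && (l y < l x)%N].
Proof.
move=> JS; have JW := subsetP (genS JS).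
move: x; apply: (gen_ind hS JS) => [|s x Js Jx up [F [barx Fx Fy]]].
  exists (delta 1); split=> [||y _]; last 1 first.
  - by rewrite /delta (eq_sym 1%g) => + /negbTE y1; rewrite y1 eqxx.
  - rewrite Hw_1 rmorph1 /expand (bigD1 1%g) ?group1//=.
    rewrite big1 => [|x /andP[_ /negbTE x1]].
      by rewrite /delta eqxx scale1r Hw_1 addr0.
    by rewrite /delta eq_sym x1 scale0r.
  - by rewrite /delta eqxx.
have Ss := subsetP JS _ Js; have Wx := JW _ Jx.
have Wg : s \in <<J>>%g by apply: mem_gen.
have up' : (l (s * x)%g < l x)%N = false by rewrite ltnNge ltnW.
exists (fun y => Lop S s F y - d * F y); split.
- by rewrite -T_Hw_up// rmorphM /= barx barT_expand.
- by rewrite /Lop (mulSK hS)// up mulrC addrK Fx.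
move=> y Wy Fy' ysx.
have [|Fsy] := eqVneq (F (s * y)%g) 0; last first.
  have [syx|syx] := eqVneq (s * y)%g x.
    by case/eqP: ysx; rewrite -syx (mulSK hS).
  have Wsy : (s * y)%g \in W by rewrite memS.
  have /andP[Jsy lt] := Fy _ Wsy Fsy syx.
  move: Jsy; rewrite groupMl// => ->/=.
  apply: leq_ltn_trans up; apply: leq_trans lt.
  by rewrite -{1}(mulSK hS y Ss) len_mul_le// memS.
move=> Fsy; have Fy0 : F y != 0.
  apply: contraNneq Fy' => Fy0; rewrite /Lop Fsy Fy0 mulr0.
  by case: ifP; rewrite !addr0 subr0.
have [->|yx] := eqVneq y x; first by rewrite Jx.
have /andP[-> lt] := Fy y Wy Fy0 yx.
exact: ltn_trans lt up.
Qed.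

Lemma bar_coef1 x : x \in W -> cf (bar (Hw x)) x = 1.
Proof.
by move=> Wx; have [F [-> Fx _]] := bar_Hw (subxx S) Wx; rewrite cf_expand.
Qed.

Lemma bar_coef J x y : J \subset S -> x \in <<J>>%g -> y \in W ->
  cf (bar (Hw x)) y != 0 -> y != x -> (y \in <<J>>%g) && (l y < l x)%N.
Proof.
move=> JS Jx Wy; have [F [-> _ Fy]] := bar_Hw JS Jx.
by rewrite cf_expand//; apply: Fy.
Qed.

(** A is a set of indices whose span is stable under bar. Modulo that span bar is still triangular,
    so at an index of maximal length outside A with nonzero coefficient no other term contributes,
    and that coefficient is itself bar-invariant. *)
Lemma bar_top (A : pred gT) F y0 : bar (expand F) = expand F ->
    (forall x y, x \in W -> y \in W -> A x -> cf (bar (Hw x)) y != 0 -> A y) ->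
    y0 \in W -> ~~ A y0 -> F y0 != 0 ->
  exists y, [/\ y \in W, ~~ A y, F y != 0, bar (F y)%:A = (F y)%:A &
    forall z, z \in W -> ~~ A z -> (l y < l z)%N -> F z = 0].
Proof.
move=> barF clA Wy0 Ay0 Fy0.
have [barK barKE] := bar_scalar (bar_v hbar).
pose P y := [&& y \in W, ~~ A y & F y != 0].
have Py0 : P y0 by rewrite /P Wy0 Ay0.
case: (@arg_maxnP _ y0 P l Py0) => y /and3P[Wy Ay Fy] maxy.
have top z : z \in W -> ~~ A z -> (l y < l z)%N -> F z = 0.
  move=> Wz Az; apply: contraTeq => Fz; rewrite -leqNgt.
  by apply: maxy; rewrite /P Wz Az.
exists y; split=> //; rewrite barKE; congr (_%:A).
rewrite -{2}(cf_expand F)// -barF rmorph_sum /=.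
have barZ x : bar (F x *: Hw x) = barK (F x) *: bar (Hw x).
  by rewrite -[F x *: _]mul1r -scalerAr scalerAl rmorphM /= barKE -scalerAl mul1r.
under eq_bigr do rewrite barZ.
rewrite cf_sum (bigD1 y)//= bar_coef1// mulr1 big1 ?addr0// => x /andP[Wx xy].
have [|rxy] := eqVneq (cf (bar (Hw x)) y) 0; first by move->; rewrite mulr0.
have yx : y != x by rewrite eq_sym.
have /andP[_ lt] := bar_coef (subxx S) Wx Wy rxy yx.
suff -> : barK (F x) = 0 by rewrite mul0r.
rewrite top//; last by apply: contra Ay => Ax; apply: clA Wx Wy Ax rxy.
by apply: alg_inj; rewrite -barKE scale0r rmorph0.
Qed.

(** * Coefficients of Kazhdan-Lusztig elements *)

Local Notation c w := (cf (C w)).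

(** The sum in [kl_basis] runs over x = w as well, so the coefficient at w is known only modulo
    vZ[v]. *)
Lemma KL_expand w : w \in W -> [/\ C w = expand (c w), in_vZv (c w w - 1) &
  forall x, x \in W -> x != w -> in_vZv (c w x)].
Proof.
move=> Ww; have [_ [p pP Cw]] := hC Ww.
have CE : C w = expand (fun x => delta w x + p x).
  rewrite Cw /expand; under [RHS]eq_bigr do rewrite scalerDl.
  rewrite big_split /=; congr (_ + _); rewrite (bigD1 w)//= /delta eqxx scale1r.
  rewrite big1 ?addr0// => x /andP[_]; rewrite eq_sym => /negbTE->.
  by rewrite scale0r.
have cE x : x \in W -> c w x = delta w x + p x.
  by move=> Wx; rewrite {1}CE cf_expand.
split; first by rewrite {1}CE; apply: eq_bigr => x Wx; rewrite cE.
  by rewrite cE// /delta eqxx addrC addKr; apply: pP.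
by move=> x Wx xw; rewrite cE// /delta eq_sym (negbTE xw) add0r; apply: pP.
Qed.

Lemma KL_Zv w x : w \in W -> x \in W -> in_Zv (c w x).
Proof.
move=> Ww Wx; have [_ cww cwx] := KL_expand Ww.
have [->|/(cwx _ Wx)/vZv_Zv//] := eqVneq x w.
by rewrite -[c w w](subrK 1); apply/in_ZvD/in_Zv1/vZv_Zv.
Qed.

Lemma KL_neq0 w : w \in W -> c w w != 0.
Proof.
move=> Ww; have [_ cww _] := KL_expand Ww.
apply/eqP => cw0; apply: vZv1N; rewrite -[1]opprK; apply: vZvN.
by move: cww; rewrite cw0 sub0r.
Qed.

Lemma bar_fixed w x : in_vZv (c w x) -> bar (c w x)%:A = (c w x)%:A -> c w x = 0.
Proof. exact: bar_fixed_vZv (bar_v hbar) alg_inj _. Qed.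

Lemma KL_support J w x : J \subset S -> w \in <<J>>%g -> x \in W ->
  c w x != 0 -> x != w -> (x \in <<J>>%g) && (l x < l w)%N.
Proof.
move=> JS Jw Wx cx xw; have Ww := subsetP (genS JS) _ Jw.
have [Cw _ cP] := KL_expand Ww.
have barC : bar (expand (c w)) = expand (c w) by rewrite -Cw (hC Ww).1.
(* A contains every index that bar can reach from w. Outside A coefficients are in vZ[v], so the
   nonzero bar-invariant one provided by [bar_top] is a contradiction. *)
pose A y := (y == w) || (y \in <<J>>%g) && (l y < l w)%N.
have clA y z : y \in W -> z \in W -> A y -> cf (bar (Hw y)) z != 0 -> A z.
  move=> _ Wz Ay rz; have [->//|zy] := eqVneq z y.
  have [Jy le_yw] : y \in <<J>>%g /\ (l y <= l w)%N.
    by case/orP: Ay => [/eqP->//|/andP[-> /ltnW]].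
  have /andP[Jz lt] := bar_coef JS Jy Wz rz zy.
  by rewrite /A Jz (leq_trans lt le_yw) orbT.
have [Ax|nAx] := boolP (A x); first by move: Ax; rewrite /A (negbTE xw).
have [y [Wy Ay /eqP cy bary _]] := bar_top barC clA Wx nAx cx.
case: cy; apply: (bar_fixed _ bary); apply: cP => //.
by apply: contra Ay => /eqP->; rewrite /A eqxx.
Qed.

(* D = (T_s - v^-1) C_w is bar-invariant, and D_{sx} = - v D_x when x < sx.
   A nonzero coefficient D_y at maximal length is bar-invariant; it must have
   sy < y, which puts it in vZ[v]. *)
Lemma KL_descent s w : s \in S -> w \in W -> (l (s * w)%g < l w)%N ->
  T s * C w = vV *: C w.
Proof.
move=> Ss Ww sw; have [Cw _ cP] := KL_expand Ww.
pose D x := Lop S s (c w) x - vV * c w x.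
have DE : T s * C w - vV *: C w = expand D.
  rewrite Cw T_expand// scaler_sumr -sumrB; apply: eq_bigr => x _.
  by rewrite scalerA -scalerBl.
have barD : bar (expand D) = expand D.
  rewrite -DE rmorphB rmorphM /= barT// -[vV *: C w]mul1r -scalerAr scalerAl.
  rewrite rmorphM /= (bar_vV (bar_v hbar)) (hC Ww).1 mulrBl -!scalerAl !mul1r.
  by rewrite -addrA -opprD -scalerDl subrK.
(* The quadratic relation reads (T_s + v)(T_s - v^-1) = 0, so T_s acts on D by -v. *)
have D_up x : x \in W -> (l (s * x)%g < l x)%N = false -> D (s * x)%g = - (v * D x).
  move=> Wx up; have := descentN hS Ss Wx; rewrite /D /Lop up => ->.
  rewrite (mulSK hS)// addr0 mulrBr [v * (vV * _)]mulrA mul_vvV mul1r.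
  by rewrite /=; ring.
suff D0 : eqW S D (fun=> 0).
  apply/eqP; rewrite -subr_eq0 DE /expand big1// => x Wx.
  by rewrite D0// scale0r.
move=> x Wx; apply: contraTeq isT => Dx.
have [//|//|y [Wy _ Dy bary top]] := @bar_top pred0 D x barD _ Wx _ Dx.
case: (boolP (l (s * y)%g < l y)%N) => [dn|/negbTE up].
  have dnN := descentN hS Ss Wy; rewrite dn in dnN.
  have Wsy : (s * y)%g \in W by rewrite memS.
  case/eqP: Dy; apply: (bar_fixed_vZv (bar_v hbar) alg_inj) bary.
  rewrite -[y](mulSK hS _ Ss) D_up//; apply: vZvN; apply/vZvP.
  exists (D (s * y)%g) => //; rewrite /D /Lop dnN (mulSK hS)// addr0.
  apply: in_ZvD; first exact: KL_Zv.
  (* Here the descent hypothesis on w enters: s is not a descent of sy, so sy is not w and its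
     coefficient can be divided by v. *)
  have /vZvP[b bZ ->] : in_vZv (c w (s * y)%g).
    apply: cP => //; apply: contraFneq dnN => sy.
    by rewrite (mulSK hS)// sy -[y](mulSK hS _ Ss) sy.
  rewrite mulrA [vV * v]mulrC mul_vvV mul1r.
  exact: in_ZvN.
have := top (s * y)%g; rewrite memS// (len_up hS)// => /(_ Wy isT (leqnn _)).
rewrite D_up// => /eqP; rewrite oppr_eq0 => /eqP vD; case/eqP: Dy.
by rewrite -[D y]mul1r -mul_vvV [v * _]mulrC -mulrA vD mulr0.
Qed.

(** * Elements having all of J as descents *)

Section Descents.
Variables (J : {set gT}) (w : gT).
Hypotheses (JS : J \subset S) (Ww : w \in W).
Hypothesis Jdesc : forall s, s \in J -> (l (s * w)%g < l w)%N.

Lemma KL_scale x : x \in <<J>>%g -> Hw x * C w = vV ^+ l x *: C w.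
Proof.
move: x; apply: (gen_ind hS JS) => [|s x Js Jx up IHx].
  by rewrite Hw_1 mul1r len1 scale1r.
have Ss := subsetP JS _ Js; have Wx := subsetP (genS JS) _ Jx.
have up' : (l (s * x)%g < l x)%N = false by rewrite ltnNge ltnW.
rewrite -T_Hw_up// -mulrA IHx -scalerAr KL_descent ?Jdesc//.
by rewrite (len_up hS)// scalerA exprSr.
Qed.

(** Compare coefficients at x in T_s C_w = v^-1 C_w: each step up in length within <J> divides the
    coefficient by v. *)
Lemma KL_coef1 x : x \in <<J>>%g -> c w 1%g = v ^+ l x * c w x.
Proof.
move: x; apply: (gen_ind hS JS) => [|s x Js Jx up ->]; first by rewrite len1 mul1r.
have Ss := subsetP JS _ Js; have Wx := subsetP (genS JS) _ Jx.
have up' : (l (s * x)%g < l x)%N = false by rewrite ltnNge ltnW.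
have := cfT (C w) Ss Wx; rewrite KL_descent ?Jdesc// /Lop up' addr0 => <-.
rewrite -[vV *: C w]addr0 cfP cf0 addr0 (len_up hS)// exprSr -mulrA [v * _]mulrA.
by rewrite mul_vvV mul1r.
Qed.

(** By [KL_coef1] the coefficients of C_w on <J> are all zero or all nonzero, and the one at w is
    nonzero; an element of <J> longer than w would lie outside the support. *)
Lemma KL_longest x : w \in <<J>>%g -> x \in <<J>>%g -> (l x <= l w)%N.
Proof.
move=> Jw Jx; rewrite leqNgt; apply/negP => lt.
have Wx := subsetP (genS JS) _ Jx.
have cx0 : c w x = 0.
  apply/eqP; apply: contraT => cx; have [xw|xw] := eqVneq x w.
    by rewrite xw ltnn in lt.
  by have /andP[_] := KL_support JS Jw Wx cx xw; rewrite ltnNge ltnW.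
case/negP: (KL_neq0 Ww); have := KL_coef1 Jw; rewrite (KL_coef1 Jx) cx0 mulr0.
move/(congr1 ( *%R (vV ^+ l w))); rewrite mulr0 mulrA -exprMn mulrC [vV * v]mulrC.
by rewrite mul_vvV expr1n mulr1 => <-.
Qed.

End Descents.

Lemma KL_square_longest J w : J \subset S -> w \in <<J>>%g ->
    (forall x, x \in <<J>>%g -> (l x <= l w)%N) ->
  exists a : laurent, C w ^+ 2 = a *: C w.
Proof.
move=> JS Jw maxw; have Ww := subsetP (genS JS) _ Jw.
have Jdesc s : s \in J -> (l (s * w)%g < l w)%N.
  move=> Js; rewrite ltn_neqAle (exch_neq hS) ?(subsetP JS)//=.
  by apply: maxw; rewrite groupM// mem_gen.
have [Cw _ _] := KL_expand Ww.
(* This is the value at C_w of the character sending each H_x to v^-l(x). *)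
exists (\sum_(x in W) c w x * vV ^+ l x).
rewrite expr2 {1}Cw /expand mulr_suml scaler_suml; apply: eq_bigr => x Wx.
have [->|cx] := eqVneq (c w x) 0; first by rewrite mul0r !scale0r mul0r.
rewrite -scalerAl (KL_scale JS)// ?scalerA//.
by have [->//|xw] := eqVneq x w; have /andP[] := KL_support JS Jw Wx cx xw.
Qed.

(* Modulo vZ[v], the operator v T_s kills H_x when x < sx and fixes it
   when sx < x. *)
Lemma Lword_mod r F x : all (mem S) r ->
    (forall y, y \in W -> in_Zv (F y)) -> x \in W ->
  in_vZv (v ^+ size r * Lword S r F x
          - if all (fun s => l (s * x)%g < l x)%N r then F x else 0).
Proof.
move=> + FZ; elim: r x => [|s r IHr] x /=.
  by rewrite mul1r subrr => *; exact: vZv0.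
case/andP=> Ss Sr Wx.
have GZ y : y \in W -> in_Zv (v ^+ size r * Lword S r F y).
  move=> Wy; set E := if all (fun s => l (s * y)%g < l y)%N r then F y else 0.
  rewrite -[X in in_Zv X](subrK E); apply: in_ZvD; first exact/vZv_Zv/IHr.
  by rewrite /E; case: ifP => _; [exact: FZ|exact/vZv_Zv/vZv0].
rewrite /Lop exprS -mulrA mulrDr; set k := v ^+ size r in GZ *.
have Wsx : (s * x)%g \in W by rewrite memS.
have vG y : y \in W -> in_vZv (v * (k * Lword S r F y)).
  by move=> Wy; apply/vZvP; exists (k * Lword S r F y) => //; exact: GZ.
case: (l (s * x)%g < l x)%N => /=; last by rewrite mulr0 addr0 subr0; apply: vG.
set E := if _ then _ else _.
(* Since v * d = 1 - v^2, the descent term reproduces the value for r up to a multiple of v. *)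
have -> : v * (k * Lword S r F (s * x)%g + k * (d * Lword S r F x)) - E =
  v * (k * Lword S r F (s * x)%g)
  + ((k * Lword S r F x - E) - v * (v * (k * Lword S r F x))).
  rewrite -[X in _ = _ + (X - _ - _)]mul1r -mul_vvV; ring.
apply: vZvD; first exact: vG; apply: vZvD; first exact: IHr.
apply/vZvN/vZvMl; [exact/vZv_Zv/vZv_v|exact: vG].
Qed.

(** The value v^-1 is a root of the quadratic relation. As the character takes values in a domain,
    applying it to C_w^2 = a C_w and cancelling determines a. *)
Lemma trivial_character : exists f : {lrmorphism H -> laurent^o},
  forall x, x \in W -> f (Hw x) = vV ^+ l x.
Proof.
have rel : hecke_relations (B := laurent^o) S (fun=> vV).
  split=> [s t _ _|s _].
    by rewrite /alternating; congr bigop; apply/funext => i; rewrite !if_same.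
  suff E : vV ^+ 2 = 1 + (vV - v) * vV by exact: E.
  by rewrite mulrBl mul_vvV addrC subrK.
have [f fT] := hecke_univ hH rel; exists f.
apply: (gen_ind hS (subxx S)) => [|s x Ss Wx up IHx].
  by rewrite Hw_1 rmorph1 len1.
have up' : (l (s * x)%g < l x)%N = false by rewrite ltnNge ltnW.
by rewrite -T_Hw_up// rmorphM /= fT// IHx (len_up hS)// exprS.
Qed.

(** The support of C_w lies in lengths at most l(w), so each term is v^(l(w)-l(x)) c_x times an
    element of Z[v], and c_x is in vZ[v] unless x = w. Here E is either the character above or the
    coefficient of H_x C_w at w. *)
Lemma KL_sum_mod w (E : gT -> laurent) : w \in W ->
    (forall x, x \in W -> in_Zv (v ^+ l x * E x)) ->
  in_vZv (v ^+ l w * (\sum_(x in W) c w x * E x) - v ^+ l w * E w).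
Proof.
move=> Ww EZ; have [_ cww cP] := KL_expand Ww.
rewrite (bigD1 w)//= mulrDr addrAC mulrCA -[X in _ - X]mul1r -mulrBl.
apply: vZvD; first by rewrite mulrC; apply: vZvMl => //; exact: EZ.
rewrite mulr_sumr; apply: vZv_sum => x /andP[Wx xw].
have [->|cx] := eqVneq (c w x) 0; first by rewrite mul0r mulr0; exact: vZv0.
have /andP[_ /ltnW le_xw] := KL_support (subxx S) Ww Wx cx xw.
rewrite -(subnKC le_xw) exprD mulrCA -mulrA mulrC.
apply: vZvMl; last exact: cP.
by rewrite mulrCA; apply: in_ZvM; [exact: in_Zv_v|exact: EZ].
Qed.

Lemma KL_square_scalar w (a : laurent) : w \in W -> C w ^+ 2 = a *: C w ->
  in_vZv (v ^+ l w * a - 1).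
Proof.
move=> Ww Caw; have [Cw cww cP] := KL_expand Ww.
have [f fH] := trivial_character.
have vK k : v ^+ k * vV ^+ k = 1 by rewrite -exprMn mul_vvV expr1n.
have fC : in_vZv (v ^+ l w * f (C w) - 1).
  have -> : f (C w) = \sum_(x in W) c w x * vV ^+ l x.
    by rewrite {1}Cw linear_sum; apply: eq_bigr => x Wx; rewrite linearZ /= fH.
  rewrite -[1](vK (l w)); apply: KL_sum_mod => // x _.
  by rewrite vK; exact: in_Zv1.
suff <- : f (C w) = a by [].
have f0 : f (C w) != 0.
  apply/eqP => f0; apply: vZv1N; rewrite -[1]opprK; apply: vZvN.
  by move: fC; rewrite f0 mulr0 sub0r.
apply: (laurent_mulIf f0); have /(congr1 f) := Caw.
by rewrite expr2 rmorphM linearZ.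
Qed.

Lemma KL_square_descents w (a : laurent) r : w \in W -> C w ^+ 2 = a *: C w ->
  reduced S w r -> all (fun s => l (s * w)%g < l w)%N r.
Proof.
move=> Ww Caw wr; have [Cw cww cP] := KL_expand Ww.
have HC x u : x \in W -> reduced S x u -> cf (Hw x * C w) w = Lword S u (c w) w.
  move=> Wx xu; have /andP[/andP[Su _] _] := xu.
  by rewrite (hHw Wx xu) {1}Cw prodT_expand// cf_expand.
have cZ := KL_Zv Ww.
have sumE : a * c w w = \sum_(x in W) c w x * cf (Hw x * C w) w.
  transitivity (cf (C w ^+ 2) w); first by rewrite Caw -[a *: _]addr0 cfP cf0 addr0.
  rewrite expr2 {1}Cw mulr_suml -cf_sum; congr (cf _ w).
  by apply: eq_bigr => x _; rewrite scalerAl.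
have modw x u : x \in W -> reduced S x u -> in_vZv (v ^+ l x * cf (Hw x * C w) w
    - if all (fun s => l (s * w)%g < l w)%N u then c w w else 0).
  move=> Wx xu; rewrite (HC _ _ Wx xu); have /andP[/andP[Su _] /eqP<-] := xu.
  exact: Lword_mod.
have EZ x : x \in W -> in_Zv (v ^+ l x * cf (Hw x * C w) w).
  move=> Wx; have [u xu] := reduced_exists Wx.
  set b := if all (fun s => l (s * w)%g < l w)%N u then c w w else 0.
  rewrite -[X in in_Zv X](subrK b); apply: in_ZvD; first exact/vZv_Zv/modw.
  by rewrite /b; case: ifP => _; [exact: cZ|exact/vZv_Zv/vZv0].
have := KL_sum_mod Ww EZ; rewrite -sumE; have := modw w r Ww wr.
case: ifP => // _ m1 m2; exfalso; apply: vZv1N.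
(* Modulo vZ[v], [m1] and [m2] make v^l(w) a c_w(w) equal to 0, whereas [m3] and [cww] make it 1. *)
have m3 := vZvMl (cZ _ Ww) (KL_square_scalar Ww Caw).
have := vZvD (vZvD m1 m2) (vZvN (vZvD m3 cww)).
set z := v ^+ l w; set e := cf _ w.
suff -> : z * e - 0 + (z * (a * c w w) - z * e)
    - (c w w * (z * a - 1) + (c w w - 1)) = 1.
  by [].
by ring.
Qed.

Lemma KL_square_iff w : w \in W ->
  (exists a : laurent, C w ^+ 2 = a *: C w) <->
  (exists2 W' : {set gT}, parabolic S W' & longest_element S W' w).
Proof.
move=> Ww; split=> [[a Caw]|[_ [J JS ->] [Jw maxw]]]; last first.
  exact: KL_square_longest JS Jw maxw.
have [r wr] := reduced_exists Ww.
have desc := KL_square_descents Ww Caw wr.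
have /andP[/andP[Sr /eqP rw] _] := wr.
pose J := [set s in r]; have JS : J \subset S.
  by apply/subsetP => s; rewrite inE; exact: (allP Sr).
have Jw : w \in <<J>>%g.
  by rewrite -rw; apply: prod_mem_gen; apply/allP => s; rewrite !inE.
exists <<J>>%g; first by exists J.
split=> // x Jx; apply: KL_longest JS Ww _ _ Jw Jx => s.
by rewrite inE; exact: (allP desc).
Qed.

End KazhdanLusztig.

Theorem proposition8 (R : realType) (n : nat) (Phi Delta : seq 'rV[R]_n)
    (hPhi : root_system Phi) (hDelta : root_base Phi Delta)
    (H : algType laurent) (T : {perm seq_sub Phi} -> H)
    (hH : hecke_algebra (simple_reflections Phi Delta) T)
    (Hw : {perm seq_sub Phi} -> H)
    (hHw : standard_basis (weyl_group Phi) (simple_reflections Phi Delta) T Hw)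
    (bar : {rmorphism H -> H})
    (hbar : bar_involution (simple_reflections Phi Delta) T bar)
    (C : {perm seq_sub Phi} -> H)
    (hC : kl_basis (weyl_group Phi) Hw bar C)
    (w : {perm seq_sub Phi}) (hw : w \in weyl_group Phi) :
  (exists a : laurent, C w ^+ 2 = a *: C w) <->
  (exists2 W' : {set {perm seq_sub Phi}},
     parabolic (simple_reflections Phi Delta) W' &
     longest_element (simple_reflections Phi Delta) W' w).
Proof.
rewrite (weyl_group_gen hPhi hDelta) in hHw hC hw.
have [cf [cfP cfT cf1]] := regular_coef (weyl_exchange hPhi hDelta) hH.
exact: (KL_square_iff (weyl_exchange hPhi hDelta) hH hHw hbar hC cfP cfT cf1 hw).
Qed.
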